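(* Let $W$ be a finite-dimensional vector space over $\mathbb F$. Every nil-polynomial $\mathbf p$ on $W$ is uniquely determined by its quadratic and cubic terms $\mathbf p^{[2]}$ and $\mathbf p^{[3]}$. In fact, the other homogeneous parts $\mathbf p^{[k]}$ are recursively determined by $$\mathbf p^{[k]}(x)=\frac1{k!}\,\omega_k(x,\dots,x)\qquad\text{and}\qquad\omega_{k+1}(x_0,x_1,\dots,x_k)=\omega_k(x_0\cdot x_1,x_2,\dots,x_k)$$ for all $k\ge2$ and $x,x_0,x_1,\dots,x_k\in W$.
   Context: $\mathbb F$ is a field of characteristic $0$; all algebras are associative $\mathbb F$-algebras. An admissible algebra is a commutative nilpotent algebra $\mathcal N$ of finite dimension over $\mathbb F$ whose annihilator $\mathcal N_{[1]}=\{x\in\mathcal N:x\mathcal N=0\}$ has dimension $1$. A pointing on $\mathcal N$ is a linear form $\omega:\mathcal N\to\mathbb F$ with $\omega(\mathcal N_{[1]})=\mathbb F$. A polynomial $\mathbf p\in\mathbb F[W]$ (the algebra of $\mathbb F$-valued polynomials on $W$) is a nil-polynomial if there are an admissible algebra $\mathcal N$, a pointing $\omega$ on $\mathcal N$ and a linear isomorphism $\phi:W\to\ker(\omega)$ with $\mathbf p=\omega\circ\exp_2\circ\phi$, where $\exp_2(x)=\sum_{k\ge2}x^k/k!$. Write $\mathbf p=\sum_{k\ge2}\mathbf p^{[k]}$ with $\mathbf p^{[k]}$ homogeneous of degree $k$, and let $\omega_k$ be the symmetric $k$-linear form on $W$ given by $\omega_k(x_1,\dots,x_k)=\omega\big((\phi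 x_1)(\phi x_2)\cdots(\phi x_k)\big)$. Then $\mathbf p^{[k]}(x)=\frac1{k!}\omega_k(x,\dots,x)$ and $\omega_2$ is non-degenerate on $W$. The commutative product $(x,y)\mapsto x\cdot y$ on $W$ is defined by $\omega_2(x\cdot y,z)=\omega_3(x,y,z)$ for all $z\in W$; it depends only on $\mathbf p^{[2]}$ and $\mathbf p^{[3]}$. *)

(* Defs.v *)
From HB Require Import structures.
From mathcomp Require Import all_boot all_order all_algebra.
From mathcomp Require Import mpoly.
Set Implicit Arguments.
Unset Strict Implicit.
Unset Printing Implicit Defensive.
Import GRing.Theory.
Local Open Scope ring_scope.

(* MathComp algebras are unital, so a non-unital algebra is given here as a
   vector space with a bilinear product.  [aprod] is the product of a nonempty
   list; its value on [::] is junk. *)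
Definition aprod (F : fieldType) (N : vectType F) (mul : N -> N -> N)
    (s : seq N) : N :=
  if s is x :: s' then foldl mul x s' else 0.

(* { x | x N = 0 }, as the kernel of x |-> (y |-> x y); see [mem_annihilator]. *)
Definition annihilator (F : fieldType) (N : vectType F) (mul : N -> N -> N) :
    {vspace N} :=
  lker (linfun (fun x => linfun (mul x))).

Record admissible (F : fieldType) := Admissible {
  carrier :> vectType F;
  amul : carrier -> carrier -> carrier;
  amul_bilin : forall (a : F) (x y z : carrier),
    amul (a *: x + y) z = a *: amul x z + amul y z;
  amulC : commutative amul;
  amulA : associative amul;
  amul_nilpotent : exists n : nat,
    forall s : seq carrier, size s = n.+1 -> aprod amul s = 0;
  dim_annihilator : \dim (annihilator amul) = 1%N
}.

Definition apow (F : fieldType) (N : admissible F) (x : N) (k : nat) : N :=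
  aprod (@amul F N) (nseq k x).

Lemma apow_nilpotent (F : fieldType) (N : admissible F) (x : N) :
  exists n : nat, apow x n.+1 == 0.
Proof.
have [n Hn] := amul_nilpotent N.
by exists n; rewrite /apow Hn // size_nseq.
Qed.

Definition nil_order (F : fieldType) (N : admissible F) (x : N) : nat :=
  ex_minn (apow_nilpotent x).

(* The terms x^k/k! with k > nil_order x vanish; see [exp2E]. *)
Definition exp2 (F : fieldType) (N : admissible F) (x : N) : N :=
  \sum_(2 <= k < (nil_order x).+1) (k`!%:R^-1 : F) *: apow x k.

Definition pointing (F : fieldType) (N : admissible F) (omega : 'Hom(N, F^o)) :
    Prop :=
  (omega @: annihilator (@amul F N))%VS = fullv.

Definition iso_onto_ker (F : fieldType) (W : vectType F) (N : admissible F)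
    (omega : 'Hom(N, F^o)) (phi : 'Hom(W, N)) : Prop :=
  lker phi = 0%VS /\ limg phi = lker omega.

(* F[W]: polynomials in the coordinates with respect to the library's fixed
   basis of W.  Degrees do not depend on that choice, and as F is infinite in
   characteristic 0, polynomials are the same as polynomial functions. *)
Definition polyOn (F : fieldType) (W : vectType F) := {mpoly F[\dim {:W}]}.

Definition peval (F : fieldType) (W : vectType F) (p : polyOn W) (x : W) : F :=
  p.@[fun i => coord (vbasis {:W}) i x].

Definition hpart (F : fieldType) (W : vectType F) (k : nat) (p : polyOn W) :
    polyOn W :=
  pihomog mdeg k p.

Definition nil_realization (F : fieldType) (W : vectType F) (p : polyOn W)
    (N : admissible F) (omega : 'Hom(N, F^o)) (phi : 'Hom(W, N)) : Prop :=
  [/\ pointing omega, iso_onto_ker omega phi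
    & forall x : W, peval p x = omega (exp2 (phi x))].

Definition nil_polynomial (F : fieldType) (W : vectType F) (p : polyOn W) :
    Prop :=
  exists (N : admissible F) (omega : 'Hom(N, F^o)) (phi : 'Hom(W, N)),
    nil_realization p omega phi.

(* omega_k(x_1, ..., x_k) = omega((phi x_1) ... (phi x_k)), for k >= 1. *)
Definition nform (F : fieldType) (W : vectType F) (N : admissible F)
    (omega : 'Hom(N, F^o)) (phi : 'Hom(W, N)) (k : nat) (x : k.-tuple W) : F :=
  omega (aprod (@amul F N) (map phi x)).

Definition flat2 (F : fieldType) (W : vectType F) (N : admissible F)
    (omega : 'Hom(N, F^o)) (phi : 'Hom(W, N)) : 'Hom(W, 'Hom(W, F^o)) :=
  linfun (fun u => linfun (fun z => nform omega phi [tuple u; z] : F^o)).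

(* The preimage of omega_3(x, y, _) under u |-> omega_2(u, _).  It is
   characterized by omega_2(x . y, z) = omega_3(x, y, z) for all z; see [dotP]
   and [dot_unique]. *)
Definition dot (F : fieldType) (W : vectType F) (N : admissible F)
    (omega : 'Hom(N, F^o)) (phi : 'Hom(W, N)) (x y : W) : W :=
  (flat2 omega phi)^-1%VF
    (linfun (fun z => nform omega phi [tuple x; y; z] : F^o)).

(* [linfun f] is only meaningful for linear f. *)
Lemma linfunE (F : fieldType) (U V : vectType F) (f : U -> V) :
  linear f -> linfun f =1 f.
Proof.
move=> lin_f.
pose fL := GRing.isLinear.Build F U V _ f lin_f.
pose g : {linear U -> V} := HB.pack f fL.
exact: (lfunE g).
Qed.

Lemma amul_linear_r (F : fieldType) (N : admissible F) (x : N) :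
  linear (@amul F N x).
Proof. by move=> a y z; rewrite amulC amul_bilin !(amulC _ x). Qed.

Lemma amul0l (F : fieldType) (N : admissible F) (x : N) : amul 0 x = 0.
Proof. by have := amul_bilin (-1) 0 0 x; rewrite !scaleN1r addr0 oppr0 !addNr. Qed.

Lemma mem_annihilator (F : fieldType) (N : admissible F) (x : N) :
  x \in annihilator (@amul F N) <-> forall y, amul x y = 0.
Proof.
rewrite /annihilator memv_ker linfunE; last first.
  move=> a u v; apply/lfunP => y.
  by rewrite add_lfunE scale_lfunE !linfunE ?amul_bilin //; exact: amul_linear_r.
split=> [/eqP/lfunP x0 y | x0].
  by have := x0 y; rewrite zero_lfunE linfunE //; exact: amul_linear_r.
apply/eqP/lfunP => y; rewrite zero_lfunE linfunE ?x0 //; exact: amul_linear_r.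
Qed.

Lemma apowS (F : fieldType) (N : admissible F) (x : N) (k : nat) :
  apow x k.+2 = amul (apow x k.+1) x.
Proof.
by rewrite /apow -addn1 nseqD /= foldl_cat.
Qed.

Lemma exp2E (F : fieldType) (N : admissible F) (x : N) (m : nat) :
  (forall k, (m <= k)%N -> (2 <= k)%N -> apow x k = 0) ->
  exp2 x = \sum_(2 <= k < m) (k`!%:R^-1 : F) *: apow x k.
Proof.
have vanish k : (nil_order x < k)%N -> apow x k = 0.
  rewrite /nil_order; case: ex_minnP => n /eqP n0 _.
  elim: k => // k IHk; rewrite ltnS leq_eqVlt => /orP[/eqP<- // | ltnk].
  by case: k ltnk IHk => // k ltnk IHk; rewrite apowS IHk ?amul0l.
move=> xm0; rewrite /exp2; set n := (nil_order x).+1.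
have trunc a b : (a <= b)%N ->
    (forall k, (a <= k)%N -> (2 <= k)%N -> apow x k = 0) ->
  \sum_(2 <= k < a) (k`!%:R^-1 : F) *: apow x k =
  \sum_(2 <= k < b) (k`!%:R^-1 : F) *: apow x k.
  move=> leab a0; case: (leqP 2 a) => [a2 | a2].
    rewrite [RHS](big_cat_nat a2 leab) /= [X in _ + X]big_nat_cond.
    rewrite [X in _ + X]big1 ?addr0 // => k /andP[/andP[ak _] _].
    by rewrite a0 ?scaler0 // (leq_trans a2).
  rewrite big_geq 1?ltnW // big_nat_cond big1 // => k /andP[/andP[k2 _] _].
  by rewrite a0 ?scaler0 // (leq_trans (ltnW a2)).
case: (leqP n m) => [le | /ltnW le]; last by rewrite (trunc _ _ le).
by apply: trunc => // k nk _; exact: vanish.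
Qed.

Lemma foldl_amul (F : fieldType) (N : admissible F) (a x : N) (s : seq N) :
  foldl (@amul F N) a (x :: s) = amul a (foldl (@amul F N) x s).
Proof.
elim: s a x => //= y s IHs a x; rewrite -amulA.
exact: (IHs a (amul x y)).
Qed.

(* A nonzero element has a nonzero multiple in the annihilator. *)
Lemma annihilator_meet (F : fieldType) (N : admissible F) (a : N) :
  a != 0 -> exists s : seq N,
    foldl (@amul F N) a s != 0 /\
    foldl (@amul F N) a s \in annihilator (@amul F N).
Proof.
move=> a0; have [n Hn] := amul_nilpotent N.
suff ind k (b : N) : (forall s, size s = k -> foldl (@amul F N) b s = 0) ->
    b != 0 -> exists s, foldl (@amul F N) b s != 0 /\
      foldl (@amul F N) b s \in annihilator (@amul F N).
  by apply: (ind n) => // s sn; apply: (Hn (a :: s)); rewrite /= sn.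
elim: k b => [|k IHk] b bk b0; first by rewrite [b](bk [::]) ?eqxx in b0.
case: (boolP (b \in annihilator (@amul F N))) => [bA | bA].
  by exists [::].
have [y by0] : exists y, amul b y != 0.
  move: bA; rewrite /annihilator memv_ker => /eqP nb.
  case: (pickP (fun i : 'I_(\dim {:N}) => amul b (vbasis {:N})`_i != 0)) =>
    [j bj | b00]; first by exists (vbasis {:N})`_j.
  case: nb; apply/eqP; rewrite -memv_ker; apply/mem_annihilator => y.
  rewrite (coord_vbasis (memvf y)) -(linfunE (amul_linear_r b)) linear_sum.
  rewrite big1 // => j _; rewrite linearZ /= linfunE; last exact: amul_linear_r.
  by move/negbFE/eqP: (b00 j) => ->; rewrite scaler0.
have [|s [s0 sA]] := IHk (amul b y) _ by0; last by exists (y :: s).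
by move=> s sk; apply: (bk (y :: s)); rewrite /= sk.
Qed.

Lemma omega2_nondegenerate (F : fieldType) (W : vectType F) (N : admissible F)
    (omega : 'Hom(N, F^o)) (phi : 'Hom(W, N)) :
  pointing omega -> iso_onto_ker omega phi ->
  forall u : W, (forall z, nform omega phi [tuple u; z] = 0) -> u = 0.
Proof.
move=> pt [/eqP phi_inj phi_img] u u0.
apply/eqP; rewrite -memv0 -(eqP phi_inj) memv_ker; apply/negPn/negP => nz.
have ann0 c : c \in annihilator (@amul F N) -> omega c = 0 -> c = 0.
  move=> cA c0; apply/eqP; rewrite -memv0.
  suff /eqP <- : (annihilator (@amul F N) :&: lker omega == 0)%VS.
    by rewrite memv_cap cA memv_ker c0 eqxx.
  have := limg_ker_dim omega (annihilator (@amul F N)).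
  rewrite pt dim_annihilator dimvf /= => /eqP.
  by rewrite -[X in _ == X]add0n eqn_add2r dimv_eq0.
have ker_u b : omega b = 0 -> omega (amul (phi u) b) = 0.
  move/eqP; rewrite -memv_ker -phi_img => /memv_imgP[z _ ->]; exact: (u0 z).
have mul_u b : omega (amul (phi u) b) = 0.
  have : (omega b : F^o) \in (omega @: annihilator (@amul F N))%VS.
    by rewrite pt memvf.
  case/memv_imgP => c cA bc.
  have: omega (b - c) = 0 by rewrite linearB /= bc subrr.
  move/ker_u; rewrite -(linfunE (amul_linear_r _)) linearB /=.
  rewrite !linfunE; [|exact: amul_linear_r..].
  by rewrite (amulC _ c) (iffLR (mem_annihilator c) cA) subr0.
have [s [s0 sA]] := annihilator_meet nz.
case/negP: s0; apply/eqP/ann0 => //; case: {sA} s => [|x s].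
  by apply/eqP; rewrite /= -memv_ker -phi_img memv_img // memvf.
by rewrite foldl_amul mul_u.
Qed.

Lemma nform2_linear (F : fieldType) (W : vectType F) (N : admissible F)
    (omega : 'Hom(N, F^o)) (phi : 'Hom(W, N)) (u : W) :
  linear (fun z => nform omega phi [tuple u; z] : F^o).
Proof.
by move=> a y z; rewrite /nform /= [phi (_ + _)]linearP amul_linear_r linearP.
Qed.

Lemma nform3_linear (F : fieldType) (W : vectType F) (N : admissible F)
    (omega : 'Hom(N, F^o)) (phi : 'Hom(W, N)) (x y : W) :
  linear (fun z => nform omega phi [tuple x; y; z] : F^o).
Proof.
by move=> a u v; rewrite /nform /= [phi (_ + _)]linearP amul_linear_r linearP.
Qed.

Lemma flat2E (F : fieldType) (W : vectType F) (N : admissible F)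
    (omega : 'Hom(N, F^o)) (phi : 'Hom(W, N)) (u z : W) :
  flat2 omega phi u z = nform omega phi [tuple u; z].
Proof.
rewrite /flat2 linfunE; first by rewrite linfunE //; exact: nform2_linear.
move=> a x y; apply/lfunP => t; rewrite add_lfunE scale_lfunE.
rewrite !linfunE; [|exact: nform2_linear..].
by rewrite /nform /= [phi (_ + _)]linearP amul_bilin linearP.
Qed.

Lemma lker_flat2 (F : fieldType) (W : vectType F) (N : admissible F)
    (omega : 'Hom(N, F^o)) (phi : 'Hom(W, N)) :
  pointing omega -> iso_onto_ker omega phi -> lker (flat2 omega phi) = 0%VS.
Proof.
move=> pt iso; apply/eqP; rewrite -subv0; apply/subvP => u.
rewrite memv_ker => /eqP/lfunP u0; rewrite memv0; apply/eqP.
apply: (omega2_nondegenerate pt iso) => z.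
by rewrite -flat2E u0 zero_lfunE.
Qed.

Lemma dotP (F : fieldType) (W : vectType F) (N : admissible F)
    (omega : 'Hom(N, F^o)) (phi : 'Hom(W, N)) :
  pointing omega -> iso_onto_ker omega phi -> forall x y z : W,
  nform omega phi [tuple dot omega phi x y; z] =
  nform omega phi [tuple x; y; z].
Proof.
move=> pt iso x y z; rewrite -flat2E /dot limg_lfunVK.
  by rewrite linfunE //; exact: nform3_linear.
suff -> : limg (flat2 omega phi) = fullv by exact: memvf.
apply/eqP; rewrite eqEdim subvf /= limg_dim_eq.
  by rewrite !dimvf /= [leqLHS](_ : _ = (dim W * 1)%N) // muln1.
by rewrite lker_flat2 ?capv0.
Qed.

Lemma dot_unique (F : fieldType) (W : vectType F) (N : admissible F)
    (omega : 'Hom(N, F^o)) (phi : 'Hom(W, N)) :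
  pointing omega -> iso_onto_ker omega phi -> forall x y w : W,
  (forall z, nform omega phi [tuple w; z] = nform omega phi [tuple x; y; z]) ->
  w = dot omega phi x y.
Proof.
move=> pt iso x y w wP.
have /eqP/lker0P := lker_flat2 pt iso; apply; apply/lfunP => z.
by rewrite !flat2E wP dotP.
Qed.

(* Main.v *)
(* Comparing powers of t in p(tx) = omega(exp_2(t phi(x))) identifies p^[k].
   The difference (phi x0)(phi x1) - phi(x0 . x1) pairs to 0 under omega with
   phi W = ker omega, by definition of the dot product, and with the
   annihilator, hence with all of N; this is the recursion for omega_k.
   Polarization recovers omega_2 and omega_3 from p^[2] and p^[3], hence the
   dot product, hence every omega_k and every p^[k]. *)
Require Import Defs.
From mathcomp Require Import all_boot all_order all_algebra.
From mathcomp Require Import mpoly.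
From mathcomp Require Import ring.
Set Implicit Arguments.
Unset Strict Implicit.
Unset Printing Implicit Defensive.
Import GRing.Theory.
Local Open Scope ring_scope.

(** * Polynomials as functions in characteristic 0 *)

(** In characteristic 0 the images of 0, 1, ..., [size P] - 1 are distinct roots, too many for a
    nonzero [P]. *)
Lemma poly_horner_eq0 (F : fieldType) (P : {poly F}) :
  [pchar F] =i pred0 -> (forall t, P.[t] = 0) -> P = 0.
Proof.
move=> charF0 P0.
apply: (@roots_geq_poly_eq0 _ _ [seq i%:R | i <- iota 0 (size P)]).
- by apply/allP => t _; rewrite /root P0.
- rewrite map_inj_in_uniq ?iota_uniq // => i j _ _ eq_ij.
  wlog le_ij: i j eq_ij / (i <= j)%N => [ih|].
    by case/orP: (leq_total i j) => /ih ->.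
  apply/eqP; rewrite eqn_leq le_ij /= -subn_eq0.
  by rewrite -(iffLR (pcharf0P F) charF0) natrB // eq_ij subrr.
- by rewrite size_map size_iota.
Qed.

(** Uniqueness of base-[B] digits: the lowest digit is the residue modulo [B], and the quotient
    carries the others. *)
Lemma digits_inj (n B : nat) (a b : 'I_n -> nat) :
  (forall i, a i < B)%N -> (forall i, b i < B)%N ->
  (\sum_(i < n) a i * B ^ i = \sum_(i < n) b i * B ^ i)%N -> a =1 b.
Proof.
elim: n a b => [|n IHn] a b aB bB; first by move=> _ [].
have step (c : 'I_n.+1 -> nat) : (\sum_(i < n.+1) c i * B ^ i =
    (\sum_(i < n) c (lift ord0 i) * B ^ i) * B + c ord0)%N.
  rewrite big_ord_recl /= muln1 addnC big_distrl; congr (_ + _)%N.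
  by apply: eq_bigr => i _; rewrite /= expnSr mulnA.
rewrite !step => eq_ab.
have B0 : (0 < B)%N by apply: leq_trans (aB ord0).
have eq0 : a ord0 = b ord0.
  by have := congr1 (modn^~ B) eq_ab; rewrite /= !modnMDl !modn_small.
have eqS : (\sum_(i < n) a (lift ord0 i) * B ^ i =
            \sum_(i < n) b (lift ord0 i) * B ^ i)%N.
  have := congr1 (divn^~ B) eq_ab.
  by rewrite /= !divnMDl // !divn_small // !addn0.
move=> i; case: (unliftP ord0 i) => [j|] -> //.
exact: (IHn (fun j => a (lift ord0 j)) (fun j => b (lift ord0 j))).
Qed.

(* Kronecker substitution: with B larger than every exponent in p, putting
   t^(B^i) for the i-th variable sends distinct monomials to distinct powers
   of t. *)
Lemma meval_eq0 (F : fieldType) (n : nat) (p : {mpoly F[n]}) :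
  [pchar F] =i pred0 -> (forall v, p.@[v] = 0) -> p = 0.
Proof.
move=> charF0 p0; pose B := msize p.
pose code (m : 'X_{1..n}) := (\sum_(i < n) m i * B ^ i)%N.
pose P : {poly F} := \sum_(m <- msupp p) p@_m *: 'X^(code m).
have P0 : P = 0.
  apply: (poly_horner_eq0 charF0) => t.
  rewrite -(p0 (fun i : 'I_n => t ^+ (B ^ i))) mevalE horner_sum.
  apply: eq_bigr => m _; rewrite hornerZ hornerXn -prodrXr; congr (_ * _).
  by apply: eq_bigr => i _; rewrite -exprM mulnC.
have ltB m i : m \in msupp p -> (m i < B)%N.
  move=> /msize_mdeg_lt; apply: leq_ltn_trans.
  by rewrite mdegE (bigD1 i) //= leq_addr.
apply/mpolyP => m; rewrite mcoeff0.
case: (boolP (m \in msupp p)) => [mp|]; last exact: memN_msupp_eq0.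
(* As [code] is injective on the support, only [m] itself contributes to the coefficient of [P] at
   [code m]. *)
have /polyP/(_ (code m)) := P0; rewrite coef0 coef_sum.
rewrite (bigD1_seq m) ?msupp_uniq //= coefZ coefXn eqxx mulr1.
rewrite big_seq_cond big1 ?addr0 // => m' /andP[m'p ne].
rewrite coefZ coefXn; case: eqP => [eq_code|]; last by rewrite mulr0.
case/eqP: ne; apply/esym/mnmP; apply: (@digits_inj n B) eq_code => i;
  exact: ltB.
Qed.

(** Every vector of scalars is the coordinate vector of some [x] in [W], so [p - q] vanishes at all
    scalar arguments. *)
Lemma peval_inj (F : fieldType) (W : vectType F) (p q : polyOn W) :
  [pchar F] =i pred0 -> (forall x, peval p x = peval q x) -> p = q.
Proof.
move=> charF0 eq_pq; apply/subr0_eq; apply: (meval_eq0 charF0) => v.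
pose x : W := \sum_(i < \dim {:W}) v i *: (vbasis {:W})`_i.
have xv : (fun i => coord (vbasis {:W}) i x) =1 v.
  by move=> i; rewrite /x coord_sum_free // (basis_free (vbasisP _)).
by rewrite mevalB -!(meval_eq _ xv) -[X in X - _]/(peval p x) eq_pq subrr.
Qed.

Lemma hpart_inj (F : fieldType) (W : vectType F) (p q : polyOn W) :
  (forall k, hpart k p = hpart k q) -> p = q.
Proof.
move=> eq_pq; pose K := maxn (msize p) (msize q).
rewrite (@pihomog_partitionE _ _ mdeg K p) ?leq_maxl //.
rewrite [RHS](@pihomog_partitionE _ _ mdeg K q) ?leq_maxr //.
by apply: eq_bigr => k _; exact: eq_pq.
Qed.

(** * Homogeneous parts along the line t x *)

Lemma peval_hpartE (F : fieldType) (W : vectType F) (p : polyOn W) (k : nat)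
    (x : W) :
  peval (hpart k p) x = \sum_(m <- msupp p | mdeg m == k)
     p@_m * \prod_i coord (vbasis {:W}) i x ^+ m i.
Proof.
rewrite /peval /hpart pihomogE raddf_sum /=.
by apply: eq_bigr => m _; rewrite mevalZ mevalX.
Qed.

Lemma peval_scale (F : fieldType) (W : vectType F) (p : polyOn W) (t : F)
    (x : W) :
  peval p (t *: x) =
  (\sum_(m <- msupp p) (p@_m * \prod_i coord (vbasis {:W}) i x ^+ m i)
       *: 'X^(mdeg m)).[t].
Proof.
rewrite horner_sum /peval mevalE; apply: eq_bigr => m _.
rewrite hornerZ hornerXn -mulrA; congr (_ * _).
rewrite mdegE -prodrXr -big_split /=; apply: eq_bigr => i _.
by rewrite linearZ /= exprMn mulrC.
Qed.

(* Both sides are the coefficient of t^k in p(tx). *)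
Lemma hpart_coeff (F : fieldType) (W : vectType F) (p : polyOn W) (x : W)
    (Q : {poly F}) (k : nat) : [pchar F] =i pred0 ->
  (forall t, peval p (t *: x) = Q.[t]) -> peval (hpart k p) x = Q`_k.
Proof.
move=> charF0 pQ; rewrite peval_hpartE.
set P := \sum_(m <- msupp p) (p@_m * \prod_i coord (vbasis {:W}) i x ^+ m i)
       *: 'X^(mdeg m).
have /subr0_eq <- : P - Q = 0.
  apply: (poly_horner_eq0 charF0) => t.
  by rewrite hornerD hornerN -pQ peval_scale subrr.
rewrite coef_sum big_mkcond /=; apply: eq_bigr => m _.
by rewrite coefZ coefXn eq_sym; case: eqP => _; rewrite ?mulr1 ?mulr0.
Qed.

(** Unlike [nil_order], the bound is uniform in [x], so one truncation of exp_2 serves every point t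
    phi(x) of a line. *)
Lemma apow_eq0 (F : fieldType) (N : admissible F) :
  exists n, forall (x : N) k, (n < k)%N -> apow x k = 0.
Proof.
have [n n0] := amul_nilpotent N; exists n => x.
elim=> // k IHk; rewrite ltnS leq_eqVlt => /orP[/eqP<-|ltnk].
  by rewrite /apow n0 // size_nseq.
by case: k ltnk IHk => // k ltnk IHk; rewrite apowS IHk ?amul0l.
Qed.

Lemma apowZ (F : fieldType) (N : admissible F) (t : F) (x : N) (k : nat) :
  apow (t *: x) k.+1 = t ^+ k.+1 *: apow x k.+1.
Proof.
have mulZl a (y z : N) : amul (a *: y) z = a *: amul y z.
  by rewrite -[a *: y]addr0 amul_bilin amul0l addr0.
elim: k => [|k IHk]; first by rewrite /apow /= expr1.
by rewrite !apowS IHk mulZl amulC mulZl scalerA -exprSr amulC.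
Qed.

Lemma peval_hpart_apow (F : fieldType) (W : vectType F) (p : polyOn W)
    (N : admissible F) (omega : 'Hom(N, F^o)) (phi : 'Hom(W, N)) (k : nat)
    (x : W) : [pchar F] =i pred0 -> nil_realization p omega phi ->
  peval (hpart k p) x =
  if (2 <= k)%N then k`!%:R^-1 * omega (apow (phi x) k) else 0.
Proof.
move=> charF0 [_ _ pE]; have [n n0] := apow_eq0 N.
(* Coefficients of t^j in omega(exp_2(t phi(x))): none below degree 2, and none above [n] because
   those powers vanish. *)
pose c j : F := if (2 <= j)%N then j`!%:R^-1 * omega (apow (phi x) j) else 0.
rewrite (@hpart_coeff _ _ _ _ (\poly_(j < n.+1) c j)) //.
  rewrite coef_poly /c; case: ltnP => // ltnk; case: ifP => // _.
  by rewrite n0 // linear0 mulr0.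
move=> t; rewrite pE (@exp2E _ _ _ n.+1); last by move=> j nj _; rewrite n0.
rewrite horner_poly linear_sum /= big_geq_mkord /= [RHS]big_mkcond.
rewrite [LHS]big_mkcond; apply: eq_bigr => j _; rewrite /c.
case: ifP => [j2|]; last by rewrite mul0r.
case: (val j) j2 => // i _; rewrite [phi _]linearZ /= apowZ !linearZ /=.
by rewrite -mulrA [omega _ * _]mulrC.
Qed.

(** * The recursion for omega_k *)

(* N is the sum of ker omega = phi W and the annihilator, which every product
   kills. *)
Lemma omega_mul_eq (F : fieldType) (W : vectType F) (N : admissible F)
    (omega : 'Hom(N, F^o)) (phi : 'Hom(W, N)) (a b : N) :
  pointing omega -> iso_onto_ker omega phi ->
  (forall z, omega (amul a (phi z)) = omega (amul b (phi z))) ->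
  forall c, omega (amul a c) = omega (amul b c).
Proof.
move=> pt [_ phi_img] eq_ab c.
have : (omega c : F^o) \in (omega @: annihilator (@amul F N))%VS.
  by rewrite pt memvf.
case/memv_imgP => d /mem_annihilator dA cd.
have : c - d \in limg phi by rewrite phi_img memv_ker linearB /= cd subrr.
case/memv_imgP => z _ cdz.
have mulc u : amul u c = amul u (phi z).
  have -> : c = 1 *: phi z + d by rewrite scale1r -cdz subrK.
  by rewrite amul_linear_r (amulC u d) dA scale1r addr0.
by rewrite !mulc.
Qed.

(** The tuple [x] is nonempty: with no further factor the right side would be omega(phi(x0 . x1)) =
    0, whatever omega_2(x0, x1) is. *)
Lemma nform_dot (F : fieldType) (W : vectType F) (N : admissible F)
    (omega : 'Hom(N, F^o)) (phi : 'Hom(W, N)) (k : nat) (x0 x1 : W)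
    (x : k.+1.-tuple W) : pointing omega -> iso_onto_ker omega phi ->
  nform omega phi [tuple of x0 :: x1 :: x] =
  nform omega phi [tuple of dot omega phi x0 x1 :: x].
Proof.
move=> pt iso; rewrite /nform /=; case: (tval x) (size_tuple x) => //= y s _.
(* Gathering the remaining factors into one element leaves (phi x0)(phi x1) and phi(x0 . x1) to be
   compared against it. *)
have assoc u : foldl (@amul F N) (amul u (phi y)) (map phi s) =
    amul u (foldl (@amul F N) (phi y) (map phi s)) by exact: foldl_amul.
rewrite !assoc.
apply: (omega_mul_eq pt iso) => z.
exact/esym/(dotP pt iso).
Qed.

(** * Polarization of omega_2 and omega_3 *)

Lemma nform2_polarization (F : fieldType) (W : vectType F) (N : admissible F)
    (omega : 'Hom(N, F^o)) (phi : 'Hom(W, N)) (x y : W) :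
  let Q u := nform omega phi [tuple u; u] in
  2%:R * nform omega phi [tuple x; y] = Q (x + y) - Q x - Q y.
Proof.
rewrite /nform /=; have Dr (u v w : N) : amul u (v + w) = amul u v + amul u w.
  by have := amul_linear_r u 1 v w; rewrite !scale1r.
have Dl (u v w : N) : amul (u + v) w = amul u w + amul v w.
  by rewrite amulC Dr !(amulC w).
rewrite [phi (_ + _)]linearD Dl !Dr !linearD (amulC (phi y) (phi x)) /=.
by ring.
Qed.

(** Inclusion-exclusion over the nonempty subsets of {x, y, z} leaves the 3! = 6 orderings of the
    product, equal by commutativity. *)
Lemma nform3_polarization (F : fieldType) (W : vectType F) (N : admissible F)
    (omega : 'Hom(N, F^o)) (phi : 'Hom(W, N)) (x y z : W) :
  let C u := nform omega phi [tuple u; u; u] in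
  6%:R * nform omega phi [tuple x; y; z] =
  C (x + y + z) - C (x + y) - C (x + z) - C (y + z) + C x + C y + C z.
Proof.
rewrite /nform /=; have Dr (u v w : N) : amul u (v + w) = amul u v + amul u w.
  by have := amul_linear_r u 1 v w; rewrite !scale1r.
have Dl (u v w : N) : amul (u + v) w = amul u w + amul v w.
  by rewrite amulC Dr !(amulC w).
have ACl (u v w : N) : amul (amul u v) w = amul (amul u w) v.
  by rewrite -!amulA (amulC v).
rewrite !linearD /= !(Dl, Dr) !linearD /=.
(* Sort the factors of each monomial into the order x, y, z. *)
rewrite !(ACl _ (phi y) (phi x)) !(ACl _ (phi z) (phi x)).
rewrite !(amulC (phi y) (phi x)) !(amulC (phi z) (phi x)).
rewrite !(amulC (phi z) (phi y)) !(ACl _ (phi z) (phi y)).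
rewrite !(amulC (phi z) (phi y)).
by ring.
Qed.

(** * Determination by the quadratic and cubic terms *)

Lemma natf_neq0_char0 (F : fieldType) (n : nat) :
  [pchar F] =i pred0 -> (0 < n)%N -> (n%:R : F) != 0.
Proof. by move=> charF0; rewrite (iffLR (pcharf0P F) charF0) -lt0n. Qed.

Lemma peval_hpart (F : fieldType) (W : vectType F) (p : polyOn W)
    (N : admissible F) (omega : 'Hom(N, F^o)) (phi : 'Hom(W, N)) (k : nat)
    (x : W) : [pchar F] =i pred0 ->
  nil_realization p omega phi ->
  peval (hpart k.+2 p) x =
  k.+2`!%:R^-1 * nform omega phi [tuple of nseq k.+2 x].
Proof.
move=> charF0 real.
by rewrite (peval_hpart_apow _ _ charF0 real) /apow -map_nseq.
Qed.

(** The two realizations may live in different algebras; they are compared through the values of the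
    common homogeneous part on [W], where the factorial cancels. *)
Lemma nform_diag_eq (F : fieldType) (W : vectType F) (p q : polyOn W)
    (N N' : admissible F) (omega : 'Hom(N, F^o)) (omega' : 'Hom(N', F^o))
    (phi : 'Hom(W, N)) (phi' : 'Hom(W, N')) (k : nat) :
  [pchar F] =i pred0 ->
  nil_realization p omega phi -> nil_realization q omega' phi' ->
  hpart k.+2 p = hpart k.+2 q -> forall x,
  nform omega phi [tuple of nseq k.+2 x] =
  nform omega' phi' [tuple of nseq k.+2 x].
Proof.
move=> charF0 realp realq eq_pq x.
have := peval_hpart k x charF0 realp.
rewrite eq_pq (peval_hpart k x charF0 realq) => /esym.
by apply: mulfI; rewrite invr_eq0 (natf_neq0_char0 charF0) ?fact_gt0.
Qed.

Lemma nform_determined (F : fieldType) (W : vectType F) (p q : polyOn W)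
    (N N' : admissible F) (omega : 'Hom(N, F^o)) (omega' : 'Hom(N', F^o))
    (phi : 'Hom(W, N)) (phi' : 'Hom(W, N')) (k : nat) (x : k.+2.-tuple W) :
  [pchar F] =i pred0 ->
  nil_realization p omega phi -> nil_realization q omega' phi' ->
  hpart 2 p = hpart 2 q -> hpart 3 p = hpart 3 q ->
  nform omega phi x = nform omega' phi' x.
Proof.
move=> charF0 realp realq /(nform_diag_eq charF0 realp realq) eq2.
move=> /(nform_diag_eq charF0 realp realq) eq3.
have {}eq2 y z : nform omega phi [tuple y; z] = nform omega' phi' [tuple y; z].
  apply: (mulfI (natf_neq0_char0 charF0 (n := 2) isT)).
  by rewrite !nform2_polarization; congr (_ - _ - _); exact: eq2.
have {}eq3 y z t :
    nform omega phi [tuple y; z; t] = nform omega' phi' [tuple y; z; t].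
  apply: (mulfI (natf_neq0_char0 charF0 (n := 6) isT)).
  rewrite !nform3_polarization; do 6?congr (_ + _); try congr (- _); exact: eq3.
have [[pt iso _] [pt' iso' _]] := (realp, realq).
(* The dot product of the first realization satisfies the property that characterizes that of the
   second. *)
have eq_dot y z : dot omega phi y z = dot omega' phi' y z.
  by apply: (dot_unique pt' iso') => t; rewrite -eq2 -eq3 dotP.
(* The induction starts at omega_2; each step merges the first two arguments into their common dot
   product. *)
elim: k x => [|k IHk] x.
  case/tupleP: x => y x; case/tupleP: x => z x; rewrite tuple0.
  exact: eq2.
case/tupleP: x => y x; case/tupleP: x => z x.
by rewrite !nform_dot // eq_dot IHk.
Qed.

Theorem mainTheorem13 (F : fieldType) (charF0 : [pchar F] =i pred0)
    (W : vectType F) :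
  (forall p q : polyOn W, nil_polynomial p -> nil_polynomial q ->
     hpart 2 p = hpart 2 q -> hpart 3 p = hpart 3 q -> p = q)
  /\
  (forall (p : polyOn W) (N : admissible F) (omega : 'Hom(N, F^o))
      (phi : 'Hom(W, N)), nil_realization p omega phi ->
   forall k : nat,
     (forall x : W,
        peval (hpart k.+2 p) x =
        (k.+2)`!%:R^-1 * nform omega phi [tuple of nseq k.+2 x])
     /\
     (forall (x0 x1 : W) (x : k.+1.-tuple W),
        nform omega phi [tuple of x0 :: x1 :: x] =
        nform omega phi [tuple of dot omega phi x0 x1 :: x])).
Proof.
split; last first.
  move=> p N omega phi real k; split=> [x|x0 x1 x]; first exact: peval_hpart.
  by have [pt iso _] := real; exact: nform_dot.
move=> p q [N [omega [phi realp]]] [N' [omega' [phi' realq]]] eq2 eq3.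
apply: hpart_inj => k; apply: (peval_inj charF0) => x.
(* Degrees 0 and 1 are not covered by [eq2] and [eq3], but there both parts vanish since exp_2
   starts at degree 2. *)
have [k1|k2] := leqP k 1.
  rewrite (peval_hpart_apow _ _ charF0 realp).
  rewrite (peval_hpart_apow _ _ charF0 realq).
  by rewrite ltnNge k1.
case: k k2 => [|[|k]] // _.
rewrite (peval_hpart _ _ charF0 realp) (peval_hpart _ _ charF0 realq).
by rewrite (nform_determined _ charF0 realp realq).
Qed.
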